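(* Let $(N_n)_{n\ge1}$ be positive integers and $(L_{n,k})_{n\ge1,\,1\le k\le N_n}$ non-negative integers such that, with $h_0:=1$ and $h_n:=N_nh_{n-1}+\sum_{k=1}^{N_n}L_{n,k}$ for $n\ge1$, $$N_{n+1}\ge e^{nN_1N_2\cdots N_n}\ (n\ge1),\qquad L_{n,k+1}>\sum_{j=1}^kL_{n,j}+k\,h_{n-1}\ (n\ge1,\ 1\le k<N_n).$$ Let $(X_0,\mathcal B_0,m_0,T_0)$ be the conservative, ergodic, measure preserving transformation obtained by the cutting and stacking construction $$B_0=1,\qquad B_n=\bigoplus_{k=1}^{N_n}B_{n-1}0^{L_{n,k}}\quad(n\ge1).$$ Then no extension $(X,\mathcal B,m,T)$ of $(X_0,\mathcal B_0,m_0,T_0)$ is quasi finite.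
   Context: Cutting and stacking notation: $B_0$ is a column consisting of a single level (an interval) of measure $1$. Given the column $B_{n-1}$ (a tower of $h_{n-1}$ disjoint intervals of equal length, each mapped by translation to the one above it), it is cut into $N_n$ subcolumns of equal width; for each $1\le k\le N_n$, $L_{n,k}$ new spacer levels (disjoint intervals of the same width) are placed on top of the $k$-th subcolumn; and the resulting subcolumns are stacked in order, the $(k+1)$-st above the $k$-th, to give the column $B_n$, of height $h_n=|B_n|$. $X_0$ is the union of all levels, $m_0$ is Lebesgue measure, and $T_0$ maps each point to the point above it in any column $B_n$ in which it is not on the top level (defined a.e.). An extension of $(X_0,\mathcal B_0,m_0,T_0)$ is a measure preserving transformation $(X,\mathcal B,m,T)$ of a $\sigma$-finite measure space with a measurable map $\pi:X\to X_0$ such that $m\circ\pi^{-1}=m_0$ and $\pi\circ T=T_0\circ\pi$ a.e. (It is automatically conservative.) For $(X,\mathcal B,m,T)$ conservative and measure preserving, and $A\in\mathcal B$ with $0<m(A)<\infty$, let $\rho_A:=\{A\cap T^{-n}A\setminus\bigcup_{j=1}^{n-1}T^{-j}A:\ n\ge1\}$ be the partition of $A$ according to first return time. The set $A$ is quasi finite if $H_A(\rho_A)<\infty$, where $H_A(\alpha)=\sum_{a\in\alpha}m_A(a)\log\frac1{m_A(a)}$ and $m_A=m(\cdot\cap A)/m(A)$. $T$ is quasi finite if there exists a quasi finite set $A$. *)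

(* Defs.v *)
From HB Require Import structures.
From mathcomp Require Import all_boot all_order all_algebra.
From mathcomp Require Import all_classical all_reals all_analysis.
Set Implicit Arguments.
Unset Strict Implicit.
Unset Printing Implicit Defensive.
Import Order.TTheory GRing.Theory Num.Theory.
Import numFieldNormedType.Exports.
Local Open Scope classical_set_scope.
Local Open Scope ring_scope.

Section CuttingAndStacking.
Variables (R : realType) (N : nat -> nat) (L : nat -> nat -> nat).
(* [x0] is the left endpoint of the level of B_0, and [sp n k j] the left
   endpoint of the j-th (from the bottom, j < L n k) spacer level placed on top
   of the k-th subcolumn (1 <= k <= N n) when B_n is built.  The values of [N]
   and [L] at 0 play no role. *)
Variables (x0 : R) (sp : nat -> nat -> nat -> R).

Fixpoint height (n : nat) : nat :=
  if n is n'.+1 then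
    (N n * height n' + \sum_(1 <= k < (N n).+1) L n k)%N
  else 1%N.

Fixpoint width (n : nat) : R :=
  if n is n'.+1 then width n' / (N n)%:R else 1.

(* The left endpoints of the levels of B_n, from bottom to top.  The k-th of
   the [N n] subcolumns of B_(n-1) is translated by (k-1) times the new
   width. *)
Fixpoint column (n : nat) : seq R :=
  if n is n'.+1 then
    flatten [seq [seq a + k.-1%:R * width n | a <- column n'] ++
                 [seq sp n k j | j <- iota 0 (L n k)]
            | k <- iota 1 (N n)]
  else [:: x0].

Lemma size_column n : size (column n) = height n.
Proof.
elim: n => [//|n IH] /=.
rewrite size_flatten /shape -map_comp sumnE big_map.
under eq_bigr => k _ do rewrite /= size_cat !size_map size_iota IH.
by rewrite big_split /= big_const_seq count_predT size_iota iter_addn_0 mulnC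
  /index_iota subSS subn0.
Qed.

Definition level (n : nat) (a : R) : set R := `[a, a + width n[%classic.

Definition disjoint_levels : Prop :=
  forall n, trivIset [set i | (i < size (column n))%N]
                     (fun i => level n (nth 0 (column n) i)).

Definition tower_space : set R :=
  \bigcup_n \bigcup_(a in [set` column n]) level n a.

(* [infix [:: a; b] (column n)]: b is the level of B_n just above a.  Nothing
   is required of [T0] at points which are on the top level of every column
   containing them. *)
Definition tower_map (T0 : R -> R) : Prop :=
  forall n a b x, infix [:: a; b] (column n) -> level n a x ->
    T0 x = b + (x - a).

End CuttingAndStacking.

Definition measure_preserving d (X : measurableType d) (R : realType)
    (m : {measure set X -> \bar R}) (T : X -> X) : Prop :=
  measurable_fun [set: X] T /\
  forall A, measurable A -> m (T @^-1` A) = m A.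

(* The base space is the subset [X0] of [Y], with the restrictions to [X0] of
   the sigma-algebra of [Y] and of [m0]. *)
Record extension d d' (X : measurableType d) (Y : measurableType d')
    (R : realType) (m : {measure set X -> \bar R}) (T : X -> X)
    (X0 : set Y) (m0 : set Y -> \bar R) (T0 : Y -> Y) (pi : X -> Y) : Prop :=
  Extension {
    extension_sigma_finite : sigma_finite [set: X] m ;
    extension_preserving : measure_preserving m T ;
    extension_range : forall x, X0 (pi x) ;
    extension_measurable : measurable_fun [set: X] pi ;
    extension_pushforward : forall B, measurable B -> B `<=` X0 ->
      m (pi @^-1` B) = m0 B ;
    extension_equivariant : {ae m, forall x, pi (T x) = T0 (pi x)} }.

Section QuasiFinite.
Context d (X : measurableType d) (R : realType).
Variables (m : {measure set X -> \bar R}) (T : X -> X).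

Definition first_return (A : set X) (n : nat) : set X :=
  (A `&` iter n T @^-1` A) `\`
  \bigcup_(j in [set j | (1 <= j < n)%N]) (iter j T @^-1` A).

Definition return_partition (A : set X) : set (set X) :=
  [set first_return A n | n in [set n | (1 <= n)%N]].

Definition normalized_measure (A B : set X) : R :=
  fine (m (B `&` A)) / fine (m A).

(* The convention 0 log (1/0) = 0 holds by computation; [esum] sums over the
   sets of the partition, not over an indexing of it. *)
Definition entropy (A : set X) (alpha : set (set X)) : \bar R :=
  (\esum_(a in alpha)
     (normalized_measure A a * ln (1 / normalized_measure A a))%:E)%E.

Definition quasi_finite_set (A : set X) : Prop :=
  [/\ measurable A, (0 < m A)%E, (m A < +oo)%E &
      (entropy A (return_partition A) < +oo)%E].

Definition quasi_finite : Prop := exists A, quasi_finite_set A.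

End QuasiFinite.

(* Main.v *)
Require Import Defs.
From HB Require Import structures.
From mathcomp Require Import all_boot all_order all_algebra.
From mathcomp Require Import all_classical all_reals all_analysis.
From mathcomp Require Import measurable_realfun lra zify.

(**
Let [A] be quasi finite in an extension, and write [p s] for the normalized
measure of the set of points of [A] with first return time [s].  Charge a point
of [A] the information [ln (1 / p s)] of its return time, plus a constant; the
total charge is finite, by finiteness of the entropy.  The proof shows that the
passages through the columns cost more than any constant.

Look at the orbit of a point of the base of [B_(n+1)] while it climbs the
column.  Some of the [N_(n+1)] copies of [B_n] meet [A]; pick a visit in each of
these.  By the growth of [L], the time elapsed between two successive picked
visits determines the copy of the later one, up to two choices.  On the other
hand this time is a sum of return times, and the compositions of a number [S] into
return times, weighted by the products of the [p s / 4], have total weights that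
sum to at most 2 over all [S] ([sum_renewal_le2]).  Hence these elapsed times
cannot all be cheap: if [M] copies are visited, the total charge along the
passage is at least about [M ln K] for any [K] up to the order of [M]
([visited_blocks_cost]).  The intermediate visits to [A], which may well occur
among the spacers, are thus accounted for by adding up their charges, with no
control on where they are.

Integrating over the base of [B_(n+1)] ([visit_cost]) bounds [ln K] times the
measure [v_n] of the visited part of the base of [B_n] by a constant plus an
error of order [K w_(n+1)], where [w_n = 1 / (N_1 ... N_n)] is the width.
Take [K = N_(n+1)]: the error is of order [w_n], and [ln K >= n / w_n] by the
growth of [N], so [n v_n / w_n] is bounded.  But the fraction [v_n / w_n] of
visited columns is nondecreasing ([visited_base_cut]), and it is positive for
some [n] because [A] has positive measure ([exists_visited_base]); this is a
contradiction.

Measures are transported along the columns by [measure_base_preimage], which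
replaces the inverse that [T] may lack.
*)

Set Implicit Arguments.
Unset Strict Implicit.
Unset Printing Implicit Defensive.
Import Order.TTheory GRing.Theory Num.Theory.
Import numFieldNormedType.Exports.
Local Open Scope classical_set_scope.
Local Open Scope ring_scope.

(** * Cost of passing through visited blocks *)

Section RenewalWeight.
Variables (R : realType) (r : nat -> R).
Hypothesis r_ge0 : forall g, 0 <= r g.

(** The total weight of the compositions of [S] into positive parts, a
composition weighing the product of the weights [r g] of its parts.  The fuel
makes the recursion structural: it counts the compositions with fewer than
[fuel] parts. *)
Fixpoint renewal (fuel S : nat) : R :=
  if fuel is fuel'.+1 then
    (S == 0%N)%:R + \sum_(1 <= g < S.+1) r g * renewal fuel' (S - g)
  else 0.

Lemma renewal_ge0 fuel S : 0 <= renewal fuel S.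
Proof.
elim: fuel S => [//|fuel IH] S /=.
by rewrite addr_ge0 ?ler0n// sumr_ge0// => g _; rewrite mulr_ge0.
Qed.

(** The compositions with a given number of parts have a total weight at most
that power of the sum of the weights of the parts, so the bound is the sum of
the geometric series of ratio 1/2. *)
Lemma sum_renewal_le2 (n fuel : nat) : \sum_(1 <= g < n) r g <= 2^-1 ->
  \sum_(0 <= S < n) renewal fuel S <= 2.
Proof.
move=> r_le; elim: fuel => [|fuel IH] /=; first by rewrite big1// ler0n.
rewrite big_split /= [leRHS](_ : _ = 1 + 1 :> R)//; apply: lerD.
  case: n {IH r_le} => [|n]; first by rewrite big_geq.
  by rewrite big_nat_recl//= big1// addr0.
rewrite (eq_big_nat _ _ (F2 := fun S => \sum_(1 <= g < n | (g < S.+1)%N)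
    r g * renewal fuel (S - g))); last first.
  by move=> S /andP[_ Sn]; rewrite (big_nat_widen _ _ _ _ _ Sn).
rewrite (exchange_big_dep_nat predT)//=.
apply: (@le_trans _ _ (\sum_(1 <= g < n) r g * 2)); last first.
  by rewrite -mulr_suml -[leRHS](@mulVf _ 2)// ler_wpM2r.
rewrite big_nat [leRHS]big_nat; apply: ler_sum => g /andP[_ gn].
rewrite -mulr_sumr ler_wpM2l// (le_trans _ IH)//.
rewrite (@big_cat_nat _ _ _ g)//= ?(ltnW gn)// big_nat_cond big1 ?add0r; last first.
  by move=> S /andP[/andP[_ Sg]]; rewrite ltnS leqNgt Sg.
rewrite -{1}[g]add0n big_addn [leRHS](@big_cat_nat _ _ _ (n - g))//= ?leq_subr//.
rewrite ler_wpDr ?sumr_ge0//.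
- by move=> *; exact: renewal_ge0.
- rewrite big_mkcond; apply: ler_sum => S _; rewrite addnK.
  by case: ifP => // _; exact: renewal_ge0.
Qed.

(** The times between consecutive visits from [i] to [j] form one of the
compositions of [j - i], hence the product of the weights of these times is at
most the renewal weight.
The costs [f] bound the logarithms of the weights, and are constrained only at
visits followed by another one before time [H]. *)
Lemma expR_cost_le_renewal (v : pred nat) (f : nat -> R) (H : nat) :
  (forall i, 0 <= f i) ->
  (forall i g, (0 < g)%N -> (i + g < H)%N -> v i -> v (i + g)%N ->
    (forall j, (0 < j < g)%N -> ~~ v (i + j)%N) -> expR (- f i) <= r g) ->
  forall fuel i j, v i -> v j -> (i <= j < H)%N -> (j - i < fuel)%N ->
    expR (- \sum_(i <= t < j) f t) <= renewal fuel (j - i).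
Proof.
move=> f_ge0 f_cost; elim=> [//|fuel IH] i j vi vj /andP[ij jH] jif /=.
move: ij; rewrite leq_eqVlt => /predU1P[->|ij].
  by rewrite big_geq// oppr0 expR0 subnn big_geq// addr0.
have ex_next : exists g, (0 < g)%N && v (i + g)%N.
  by exists (j - i)%N; rewrite subn_gt0 ij subnKC// ltnW.
have [g /andP[g_gt0 vg] g_min] := ex_minnP ex_next.
have gji : (g <= j - i)%N by apply: g_min; rewrite subn_gt0 ij subnKC// ltnW.
have igj : (i + g <= j)%N by rewrite -leq_subRL// ltnW.
rewrite (_ : (j - i == 0)%N = false) ?add0r; last by apply/negbTE; lia.
rewrite (@big_cat_nat _ _ _ (i + g)) ?leq_addr//= opprD expRD.
rewrite [leRHS](bigD1_seq g) ?mem_index_iota ?iota_uniq//=; last by lia.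
rewrite ler_wpDr//.
  by rewrite sumr_ge0// => *; rewrite mulr_ge0// renewal_ge0.
apply: ler_pM; rewrite ?expR_ge0//.
- apply: (@le_trans _ _ (expR (- f i))).
    rewrite ler_expR lerN2 big_ltn ?ler_wpDr ?sumr_ge0//.
    by rewrite -[ltnLHS]addn0 ltn_add2l.
  apply: f_cost => //; first exact: leq_ltn_trans jH.
  move=> k /andP[k0 kg]; apply/negP => vk.
  by have := g_min k; rewrite k0 vk leqNgt kg => /(_ isT).
- by rewrite -subnDA; apply: IH => //; lia.
Qed.

(** The position in a column of its [k]-th copy of the previous column, of
height [h].  Copies are counted from 0, whereas [L j] spacers lie above the
copy number [j - 1]. *)
Definition offset (h : nat) (L : nat -> nat) (k : nat) : nat :=
  (k * h + \sum_(1 <= j < k.+1) L j)%N.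

Lemma offsetS h L k : offset h L k.+1 = (offset h L k + h + L k.+1)%N.
Proof. by rewrite /offset mulSn big_nat_recr//=; lia. Qed.

(** The growth of [L] makes the block number separate the time differences: if
[b] is in a block before block [k.+1] and [c] is in block [k.+1], then
[P k <= c - b < P k.+2].  Choosing one visit in each visited block, the renewal
weights of the successive differences therefore have a sum at most twice the
total renewal weight, that is at most 4: they are small on average, and the
visits between two chosen ones are expensive.  Averaging is done with
[expR x >= 1 + x], which gives [W >= ln K + 1 - K * u] for a cost [W] and a
weight [u >= expR (- W)]. *)
Lemma visited_blocks_cost (N h : nat) (L : nat -> nat) (v : pred nat)
    (f : nat -> R) (K : R) (P := offset h L) :
  (forall k, (1 <= k < N)%N -> (P k < L k.+1)%N) ->
  1 <= K ->
  \sum_(1 <= g < P N) r g <= 2^-1 ->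
  (forall i, 0 <= f i) ->
  (forall i g, (0 < g)%N -> (i + g < P N)%N -> v i -> v (i + g)%N ->
    (forall j, (0 < j < g)%N -> ~~ v (i + j)%N) -> expR (- f i) <= r g) ->
  ln K * \sum_(0 <= k < N) ([exists i : 'I_h, v (P k + i)%N])%:R
    <= \sum_(0 <= t < P N) f t + ln K + 4 * K.
Proof.
move=> L_gt K1 r_le f_ge0 f_cost.
have K0 : 0 < K by apply: lt_le_trans K1.
have lnK0 : 0 <= ln K by rewrite ln_ge0.
have PS k : P k.+1 = (P k + h + L k.+1)%N by exact: offsetS.
have Pmono : {homo P : i j / (i <= j)%N}.
  apply: homo_leq => [//|x y z|k]; first exact: leq_trans.
  by rewrite PS -addnA leq_addr.
(* [U] is the cumulated renewal weight; in [key] below, the sum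
   [U (P n.-1) + U (P n.-1 + h)] is what remains, after telescoping, of the
   weights of the overlapping windows that contain the successive differences. *)
pose u := renewal (P N); pose U t := \sum_(0 <= S < t) u S.
have U_le2 t : (t <= P N)%N -> U t <= 2.
  move=> tN; apply: le_trans (sum_renewal_le2 (P N) r_le).
  rewrite [leRHS](@big_cat_nat _ _ _ t)//= ler_wpDr// sumr_ge0// => *.
  exact: renewal_ge0.
have U_ge0 t : 0 <= U t by rewrite sumr_ge0// => *; exact: renewal_ge0.
pose vis k := [exists i : 'I_h, v (P k + i)%N].
pose M n : R := \sum_(0 <= k < n) (vis k)%:R.
suff key n : (0 < n <= N)%N -> M n = 0 \/
    exists b, [/\ v b, (b < P n.-1 + h)%N &
      ln K * (M n - 1) <= \sum_(0 <= t < b) f t + K * (U (P n.-1) + U (P n.-1 + h)%N)].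
  have [->|N0] := posnP N.
    by rewrite big_geq// mulr0 !addr_ge0 ?sumr_ge0 ?mulr_ge0// ltW.
  have sumf0 : 0 <= \sum_(0 <= t < P N) f t by rewrite sumr_ge0.
  have PNN : (P N.-1 + h <= P N)%N by rewrite -[in leqRHS](prednK N0) PS leq_addr.
  have := key N; rewrite N0 leqnn => /(_ isT)[|[b [vb bN]]].
    by rewrite /M => ->; rewrite mulr0 !addr_ge0// mulr_ge0 ?ltW.
  rewrite -/(M N) mulrBr mulr1 lerBlDr => /le_trans; apply.
  rewrite -[leRHS]addrA [ln K + _]addrC addrA lerD2r lerD//.
    rewrite [leRHS](@big_cat_nat _ _ _ b)//=; last by lia.
    by rewrite ler_wpDr// sumr_ge0.
  rewrite mulrC ler_pM2r// [leRHS](_ : _ = 2 + 2) ?lerD ?U_le2//; last by lra.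
  by apply: leq_trans PNN; rewrite leq_addr.
elim: n => [//|n IH]; rewrite ltnS /= => nN.
have {IH} : M n = 0 \/ exists b, [/\ (0 < n)%N, v b, (b < P n.-1 + h)%N &
      ln K * (M n - 1) <= \sum_(0 <= t < b) f t + K * (U (P n.-1) + U (P n.-1 + h)%N)].
  case: n nN IH => [|n] nN IH; first by left; rewrite /M big_geq.
  have [|[b [vb bn bM]]] := IH (ltnW nN); first by left.
  by right; exists b.
have MS : M n.+1 = M n + (vis n)%:R by rewrite /M big_nat_recr.
have nN' : (P n + h <= P N)%N.
  by apply: leq_trans (Pmono _ _ nN); rewrite PS leq_addr.
have Ub a b : (a <= b)%N -> U a <= U b.
  move=> ab; rewrite [leRHS](@big_cat_nat _ _ _ a)//=.
  by rewrite ler_wpDr// sumr_ge0// => *; exact: renewal_ge0.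
case=> [Mn0|[b [n0 vb bn bM]]]; rewrite MS.
  rewrite Mn0 add0r; have [/existsP[i vi]|_] := boolP (vis n); last by left.
  right; exists (P n + i)%N; split=> //; first by rewrite ltn_add2l.
  by rewrite subrr mulr0 addr_ge0 ?sumr_ge0// mulr_ge0 ?addr_ge0// ltW.
have Pn : P n = (P n.-1 + h + L n)%N by rewrite -[in LHS](prednK n0) PS prednK.
have [/existsP[i vi]|_] := boolP (vis n); right; last first.
  exists b; split=> //; first by lia.
  rewrite addr0 (le_trans bM)// lerD2l ler_pM2l// lerD// Ub//; lia.
have iLh := ltn_ord i.
exists (P n + i)%N; split=> //; first by rewrite ltn_add2l.
set c := (P n + i)%N.
have bc : (b < c)%N by rewrite /c; lia.
have cost : ln K + 1 - K * u (c - b)%N <= \sum_(b <= t < c) f t.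
  have : expR (- \sum_(b <= t < c) f t) <= u (c - b)%N.
    apply: (expR_cost_le_renewal f_ge0 f_cost) => //; rewrite /c; lia.
  rewrite -(ler_pM2l K0) -{1}[K]lnK ?posrE// -expRD => expW.
  have := expR_ge1Dx (ln K - \sum_(b <= t < c) f t).
  by move=> /le_trans /(_ expW); lra.
have uU : u (c - b)%N <= U (P n + h)%N - U (P n.-1).
  have PL : (P n.-1 <= L n)%N.
    case: (n) n0 nN => [//|[|k]] _ kN //=; last exact/ltnW/L_gt/ltnW.
    by rewrite /P /offset mul0n big_geq.
  rewrite lerBrDl; apply: (@le_trans _ _ (U (c - b)%N + u (c - b)%N)).
    by rewrite lerD2r Ub// /c; lia.
  by rewrite -[leLHS](big_nat_recr (c - b)%N)//= Ub// /c; lia.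
rewrite [X in _ <= X + _](@big_cat_nat _ _ _ b)//=; last by lia.
have {uU} := ler_wpM2l (ltW K0) uU.
have Unn1 : U (P n.-1 + h)%N <= U (P n) by rewrite Ub//; lia.
have {Unn1} := ler_wpM2l (ltW K0) Unn1.
rewrite !(mulrDr, mulrBr) in bM *; rewrite mulr1 in bM *.
lra.
Qed.

End RenewalWeight.

(** * Orbits of a measure preserving map and first returns *)

Section MeasureSums.
Context d (X : measurableType d) (R : realType) (m : {measure set X -> \bar R}).

Lemma sum_measure_disjoint_le (n : nat) (F : nat -> set X) (S : set X) :
  (forall i, (i < n)%N -> measurable (F i)) -> trivIset `I_n F ->
  measurable S -> (\sum_(0 <= i < n) m (S `&` F i) <= m S)%E.
Proof.
move=> mF tF mS; rewrite big_mkord.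
have mSF i : (i < n)%N -> measurable (S `&` F i).
  by move=> ni; apply: measurableI => //; exact: mF.
have mU : measurable (\big[setU/set0]_(i < n) (S `&` F i)).
  by apply: bigsetU_measurable => i _; exact: mSF.
rewrite -(@measure_semi_additive_ord_I _ _ _ m (fun i => S `&` F i))//; last exact: trivIset_setIl.
apply: le_measure; rewrite ?inE//.
by rewrite -(bigcup_mkord n (fun i => S `&` F i)) => x [i _ []].
Qed.

Lemma sum_indic_measure_le (D : set X) (I J : Type) (s : seq I) (t : seq J)
    (a : I -> R) (b : J -> R) (c : R) (F : I -> set X) (G : J -> set X) :
  measurable D -> (forall i, measurable (F i)) -> (forall j, measurable (G j)) ->
  (forall i, 0 <= a i) -> (forall j, 0 <= b j) -> 0 <= c ->
  (forall x, D x -> \sum_(i <- s) a i * \1_(F i) x <=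
     \sum_(j <- t) b j * \1_(G j) x + c) ->
  (\sum_(i <- s) (a i)%:E * m (F i `&` D) <=
     \sum_(j <- t) (b j)%:E * m (G j `&` D) + c%:E * m D)%E.
Proof.
move=> mD mF mG a0 b0 c0 le_FG.
have mfun k (S : set X) : measurable S ->
    measurable_fun D (fun x => (k * \1_S x)%:E).
  by move=> mS; apply/measurable_EFinP; apply: measurable_funM => //;
    exact: measurable_indic.
have intE (K : Type) (r : seq K) (k : K -> R) (S : K -> set X) :
    (forall i, measurable (S i)) -> (forall i, 0 <= k i) ->
    (\int[m]_(x in D) (\sum_(i <- r) (k i * \1_(S i) x)%:E) =
     \sum_(i <- r) (k i)%:E * m (S i `&` D))%E.
  move=> mS k0; rewrite ge0_integral_sum//; last 2 first.
  - by move=> i; exact: mfun.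
  - by move=> i x _; rewrite lee_fin mulr_ge0.
  apply: eq_bigr => i _; under eq_integral do rewrite EFinM.
  rewrite ge0_integralZl_EFin ?integral_indic//.
  by apply/measurable_EFinP; exact: measurable_indic.
have mcst : measurable_fun D (fun=> c%:E) by exact: measurable_cst.
have mG' : measurable_fun D
    (fun x => (\sum_(j <- t) (b j * \1_(G j) x)%:E)%E).
  by apply: emeasurable_sum => j; exact: mfun.
have mF' : measurable_fun D
    (fun x => (\sum_(i <- s) (a i * \1_(F i) x)%:E)%E).
  by apply: emeasurable_sum => j; exact: mfun.
rewrite -intE// -intE// -(integral_cst _ mD) -ge0_integralD//; last first.
  by move=> x _; rewrite sume_ge0// => j _; rewrite lee_fin mulr_ge0.
apply: ge0_le_integral => //.
- by move=> x _; rewrite sume_ge0// => j _; rewrite lee_fin mulr_ge0.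
- exact: emeasurable_funD.
- by move=> x Dx; rewrite !sumEFin -EFinD lee_fin; exact: le_FG.
Qed.

Variable T : X -> X.
Hypothesis T_mp : measure_preserving m T.

Lemma measurable_iter_preimage i (S : set X) :
  measurable S -> measurable (iter i T @^-1` S).
Proof.
elim: i S => [//|i IH] S mS.
rewrite [X in measurable X](_ : _ = iter i T @^-1` (T @^-1` S))//.
by apply: IH; rewrite -[_ @^-1` _]setTI; exact: T_mp.1.
Qed.

Lemma measure_iter_preimage i (S : set X) :
  measurable S -> m (iter i T @^-1` S) = m S.
Proof.
elim: i S => [//|i IH] S mS.
rewrite [X in m X](_ : _ = iter i T @^-1` (T @^-1` S))// IH ?T_mp.2//.
exact: (measurable_iter_preimage 1 mS).
Qed.

Section FirstReturns.
Variable A : set X.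
Hypothesis mA : measurable A.

Lemma measurable_first_return s : measurable (first_return T A s).
Proof.
apply: measurableD; first by apply: measurableI => //; exact: measurable_iter_preimage.
by apply: bigcup_measurable => k _; exact: measurable_iter_preimage.
Qed.

Lemma first_return_inj x s t : (0 < s)%N -> (0 < t)%N ->
  first_return T A s x -> first_return T A t x -> s = t.
Proof.
wlog st : s t / (s < t)%N => [th|] s0 t0 rs rt.
  by have [/th|/th H|//] := ltngtP s t; [exact|apply/esym/H].
by case: rt => _ []; exists s; [rewrite /= s0 st|exact: rs.1.2].
Qed.

Lemma trivIset_first_return :
  trivIset setT (fun s => first_return T A s.+1).
Proof.
apply/trivIsetP => s t _ _ /eqP st; rewrite -subset0 => x [rs rt].
by apply: st; case: (first_return_inj (ltn0Sn s) (ltn0Sn t) rs rt).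
Qed.

Hypothesis A_gt0 : (0 < m A)%E.
Hypothesis A_lty : (m A < +oo)%E.

Let p s := normalized_measure m A (first_return T A s).

Lemma measure_first_returnE s :
  m (first_return T A s) = (fine (m A) * p s)%:E.
Proof.
have rA : first_return T A s `<=` A by move=> x [[]].
have fA : m A \is a fin_num by rewrite ge0_fin_numE.
have fr : m (first_return T A s) \is a fin_num.
  rewrite ge0_fin_numE// (le_lt_trans _ A_lty)// le_measure ?inE//.
  exact: measurable_first_return.
rewrite /p /normalized_measure (setIidl rA) mulrC divfK ?fineK//.
by rewrite gt_eqF// fine_gt0// A_gt0.
Qed.

Lemma first_return_prob_ge0 s : 0 <= p s.
Proof. by rewrite /p divr_ge0// fine_ge0. Qed.

Lemma sum_first_return_prob_le1 n : \sum_(1 <= s < n) p s <= 1.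
Proof.
have a0 : 0 < fine (m A) by rewrite fine_gt0// A_gt0.
rewrite -(ler_pM2l a0) mulr1 mulr_sumr -lee_fin fineK ?ge0_fin_numE// -sumEFin.
under eq_bigr do rewrite -measure_first_returnE.
rewrite big_add1.
have := @sum_measure_disjoint_le n.-1 (fun s => first_return T A s.+1) A.
rewrite (eq_bigr (fun s => m (first_return T A s.+1))); last first.
  by move=> s _; rewrite setIidr// => x [[]].
apply => //; first by move=> *; exact: measurable_first_return.
exact: sub_trivIset trivIset_first_return.
Qed.

Lemma first_return_prob_le1 s : p s <= 1.
Proof.
have a0 : 0 < fine (m A) by rewrite fine_gt0// A_gt0.
rewrite -(ler_pM2l a0) mulr1 -lee_fin fineK ?ge0_fin_numE//.
rewrite -measure_first_returnE le_measure ?inE//; last by move=> x [[]].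
exact: measurable_first_return.
Qed.

(** The entropy runs over the return sets themselves; distinct return times
have distinct return sets as soon as these are nonempty, and the empty set
carries no information. *)
Lemma sum_first_return_info_le n :
  ((\sum_(1 <= s < n) p s * ln (1 / p s))%:E <=
     entropy m A (return_partition T A))%E.
Proof.
pose J := [set s | (s < n.-1)%N /\ first_return T A s.+1 !=set0].
have fJ : finite_set J by apply: sub_finite_set (finite_II n.-1) => s [].
apply: esum_ge; exists [set first_return T A s.+1 | s in J].
  split; first exact: finite_image.
  by move=> _ [s _ <-]; exists s.+1.
rewrite fsbig_image//; last first.
  move=> s t; rewrite !inE => -[_ [x xs]] _ st.
  have := xs; rewrite st => xt.
  by case: (first_return_inj (ltn0Sn s) (ltn0Sn t) xs xt).
rewrite big_add1 -sumEFin big_mkord.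
rewrite (fsbig_ord _ _ (fun s => (p s.+1 * ln (1 / p s.+1))%:E)).
rewrite (@fsbig_widen _ _ _ _ J `I_n.-1)//; first by move=> s [].
move=> s [sn /not_andP[//|/set0P/negP/negPn/eqP s0]] /=.
by rewrite /p /normalized_measure s0 set0I measure0 !mul0r.
Qed.

End FirstReturns.
End MeasureSums.

(** * Combinatorics of the columns *)

Lemma infix_nth (T : eqType) (y : T) (s : seq T) i :
  (i.+1 < size s)%N -> infix [:: nth y s i; nth y s i.+1] s.
Proof.
move=> si; apply/infixP; exists (take i s), (drop i.+2 s).
by rewrite -{1}[s](cat_take_drop i) (drop_nth y) ?(drop_nth y si)//= ltnW.
Qed.

Section Columns.
Variables (R : realType) (N : nat -> nat) (L : nat -> nat -> nat).
Variables (x0 : R) (sp : nat -> nat -> nat -> R).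
Hypothesis N_gt0 : forall n, (1 <= n)%N -> (0 < N n)%N.

Lemma height_gt0 n : (0 < height N L n)%N.
Proof. by elim: n => //= n IH; rewrite addn_gt0 muln_gt0 N_gt0// IH. Qed.

Lemma width_gt0 n : 0 < width R N n.
Proof. by elim: n => //= n IH; rewrite divr_gt0// ltr0n N_gt0. Qed.

Lemma widthE n : width R N n = (\prod_(1 <= i < n.+1) N i)%:R^-1.
Proof.
elim: n => [|n IH] /=; first by rewrite big_geq// invr1.
by rewrite big_nat_recr//= natrM invfM IH.
Qed.

Local Notation start n k := (offset (height N L n) (L n.+1) k).

Lemma start_le n k : (k < N n.+1)%N ->
  (start n k + height N L n <= height N L n.+1)%N.
Proof.
move=> kN; rewrite [height _ _ n.+1](_ : _ = start n (N n.+1))//.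
have mono : {homo (fun k => start n k) : i j / (i <= j)%N}.
  apply: homo_leq => [//|x y z|j]; first exact: leq_trans.
  by rewrite offsetS -addnA leq_addr.
by apply: leq_trans (mono _ _ kN); rewrite offsetS leq_addr.
Qed.

Lemma start_lt n k : (k < N n.+1)%N -> (start n k < height N L n.+1)%N.
Proof.
move=> kN; apply: leq_trans (start_le kN).
by rewrite -[ltnLHS]addn0 ltn_add2l height_gt0.
Qed.

Lemma nth_column_start n k : (k < N n.+1)%N ->
  nth 0 (column N L x0 sp n.+1) (start n k) =
  nth 0 (column N L x0 sp n) 0 + k%:R * width R N n.+1.
Proof.
move=> kN; rewrite /=; set G := (G in map G _).
have -> : iota 1 (N n.+1) = iota 1 k ++ k.+1 :: iota k.+2 (N n.+1 - k.+1).
  by rewrite -[in LHS](subnKC kN) addSnnS iotaD add1n.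
have szG : size (flatten [seq G j | j <- iota 1 k]) = start n k.
  rewrite size_flatten /shape -map_comp sumnE big_map /offset.
  under eq_bigr => j _ do rewrite /= size_cat !size_map size_iota size_column.
  rewrite big_split /= big_const_seq count_predT size_iota iter_addn_0 mulnC.
  by rewrite /index_iota subSS subn0.
rewrite map_cat flatten_cat nth_cat szG ltnn subnn /= nth_cat.
rewrite size_cat size_map size_column ltn_addr ?height_gt0// nth_cat size_map.
by rewrite size_column height_gt0 (nth_map 0) ?size_column ?height_gt0.
Qed.

Lemma bottom_level_cut n x :
  level N n (nth 0 (column N L x0 sp n) 0) x ->
  exists2 k, (k < N n.+1)%N &
    level N n.+1 (nth 0 (column N L x0 sp n.+1) (start n k)) x.
Proof.
set a := nth 0 _ 0; rewrite /level /= in_itv /= => /andP[ax xa].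
have w0 : 0 < width R N n / (N n.+1)%:R by exact: (width_gt0 n.+1).
have N0 : 0 < (N n.+1)%:R :> R by rewrite ltr0n N_gt0.
set w := width R N n / _ in w0 *.
have xw0 : 0 <= (x - a) / w by rewrite divr_ge0 ?subr_ge0 ?(ltW w0).
have := truncn_itv xw0; set k := Num.trunc _ => /andP[kx xk].
have kN : (k < N n.+1)%N.
  rewrite -(ltr_nat R) (le_lt_trans kx)// ltr_pdivrMr//.
  by rewrite /w mulrCA divff ?gt_eqF// mulr1 ltrBlDl.
exists k => //; rewrite nth_column_start// -/a in_itv /= -/w.
move: kx xk; rewrite ler_pdivlMr// ltr_pdivrMr// -natr1 mulrDl mul1r.
move=> kx xk; apply/andP; split; lra.
Qed.

End Columns.

(** * Columns lifted to an extension *)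

Section LiftedTower.
Variables (R : realType) (N : nat -> nat) (L : nat -> nat -> nat).
Hypothesis N_gt0 : forall n, (1 <= n)%N -> (0 < N n)%N.
Variables (x0 : R) (sp : nat -> nat -> nat -> R) (T0 : R -> R).
Hypothesis levels_disj : disjoint_levels N L x0 sp.
Hypothesis T0_tower : tower_map N L x0 sp T0.
Context (d : measure_display) (X : measurableType d).
Variables (m : {measure set X -> \bar R}) (T : X -> X) (pi : X -> R).
Hypothesis ext : extension m T (tower_space N L x0 sp) lebesgue_measure T0 pi.

Local Notation h n := (height N L n).
Local Notation w n := (width R N n).
Local Notation start n k := (offset (h n) (L n.+1) k).

Let T_mp : measure_preserving m T := extension_preserving ext.

Definition lifted_level n i : set X :=
  pi @^-1` level N n (nth 0 (column N L x0 sp n) i).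
Local Notation E := lifted_level.

Lemma measurable_lifted_level n i : measurable (E n i).
Proof.
rewrite -[E n i]setTI; apply: (extension_measurable ext) => //.
exact: measurable_itv.
Qed.
Hint Resolve measurable_lifted_level : core.

Lemma measure_lifted_level n i : (i < h n)%N -> m (E n i) = (w n)%:E.
Proof.
move=> ih; rewrite (extension_pushforward ext); last 2 first.
- exact: measurable_itv.
- move=> y Ly; exists n => //; exists (nth 0 (column N L x0 sp n) i) => //=.
  by rewrite mem_nth// size_column.
rewrite lebesgue_measure_itv /= lte_fin ltrDl width_gt0//.
by rewrite -EFinB addrAC subrr add0r.
Qed.

Lemma trivIset_lifted_level n : trivIset `I_(h n) (E n).
Proof.
move=> i j ih jh [x [xi xj]].
have tr := @levels_disj n.
by apply: tr; rewrite /= ?size_column//; exists (pi x).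
Qed.

Definition climbs (x : X) : Prop := forall n i j,
  E n i x -> (i + j < h n)%N -> E n (i + j) (iter j T x).

(** Equivariance holds along the whole forward orbit of almost every point,
since [T] preserves null sets; [T0] is then applied only at points that are not
on the top level of the column under consideration. *)
Lemma ae_climbs : {ae m, forall x, climbs x}.
Proof.
have [B [mB B0 PB]] := extension_equivariant ext.
have mTB i := measurable_iter_preimage T_mp i mB.
apply: (@negligibleS _ _ _ _ (\bigcup_i (iter i T @^-1` B))); last first.
  apply: negligible_bigcup => i; apply/negligibleP => //.
  exact: etrans (measure_iter_preimage T_mp i mB) B0.
move=> x /= nclimb; apply: contrapT => nBx; apply: nclimb => n i.
elim=> [|j IH] Ex ijh; first by rewrite addn0.
rewrite addnS in ijh *; have {}IH := IH Ex (ltnW ijh).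
have eqv : pi (T (iter j T x)) = T0 (pi (iter j T x)).
  apply: contrapT => neq; apply: nBx; exists j => //; exact: PB.
have inf := @infix_nth _ 0 (column N L x0 sp n) (i + j).
rewrite size_column in inf.
rewrite /E /= eqv (T0_tower (inf ijh) IH).
move: IH; rewrite /E /level /= !in_itv /= => /andP[? ?].
by apply/andP; split; lra.
Qed.

Lemma le_measure_climbs (P Q : set X) : measurable P -> measurable Q ->
  (forall x, climbs x -> P x -> Q x) -> (m P <= m Q)%E.
Proof.
move=> mP mQ PQ; have [Z [mZ Z0 sub]] := ae_climbs.
rewrite -(measureU0 mQ mZ Z0) le_measure ?inE//; first exact: measurableU.
move=> x Px; have [Zx|nZx] := pselect (Z x); [by right|left].
by apply: PQ => //; apply: contrapT => nclimb; exact/nZx/sub.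
Qed.

(** Almost every point of the base climbs into level [i], so that the base lies
in the preimage of this level up to a null set; both have the measure of a
level, hence they agree up to a null set, even though [T] need not be
invertible. *)
Lemma measure_base_preimage n i (S : set X) : (i < h n)%N ->
  measurable S -> S `<=` E n i -> m (E n 0 `&` iter i T @^-1` S) = m S.
Proof.
move=> ih mS SE; have mT := @measurable_iter_preimage _ _ _ _ _ T_mp i.
have mTE := mT _ (measurable_lifted_level n i).
apply/eqP; rewrite eq_le; apply/andP; split.
  rewrite -(measure_iter_preimage T_mp i mS) le_measure ?inE//; last first.
  - exact: mT.
  - by apply: measurableI => //; exact: mT.
have fin F : measurable F -> F `<=` iter i T @^-1` E n i -> m F \is a fin_num.
  move=> mF FE; rewrite ge0_fin_numE//.
  apply: (@le_lt_trans _ _ (m (iter i T @^-1` E n i))).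
    by rewrite le_measure ?inE.
  by rewrite (measure_iter_preimage T_mp)// measure_lifted_level// ltry.
have null : m (iter i T @^-1` E n i `\` E n 0) = 0.
  have wE : m (iter i T @^-1` E n i) = (m (iter i T @^-1` E n i `\` E n 0) +
      m (iter i T @^-1` E n i `&` E n 0))%E.
    exact: measureDI.
  rewrite (measure_iter_preimage T_mp)// measure_lifted_level// in wE.
  have : ((w n)%:E <= m (iter i T @^-1` E n i `&` E n 0))%E.
    rewrite -(@measure_lifted_level n 0) ?height_gt0//.
    apply: le_measure_climbs => //; first exact: measurableI.
    move=> x climb Ex; split=> //.
    by have := climb n 0%N i Ex; rewrite add0n => /(_ ih).
  set D := m (_ `\` _) in wE *; set I := m (_ `&` _) in wE *.
  have D0 : (0 <= D)%E by exact: measure_ge0.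
  have fD : D \is a fin_num by apply: fin; [exact: measurableD|exact: subDsetl].
  have fI : I \is a fin_num by apply: fin; [exact: measurableI|exact: subIsetl].
  move: wE D0; rewrite -(fineK fD) -(fineK fI) => -[->].
  by rewrite !lee_fin => ? ?; congr EFin; lra.
have mTS := mT _ mS.
rewrite -(measure_iter_preimage T_mp i mS).
rewrite [leLHS](measureDI m mTS (measurable_lifted_level n 0)).
rewrite [X in (X + _)%E](_ : _ = 0) ?add0e 1?setIC//.
apply/eqP; rewrite -measure_le0 -null le_measure ?inE//; try exact: measurableD.
by apply: setSD => x /SE.
Qed.

Section Visits.
Variable A : set X.
Hypothesis mA : measurable A.

Definition visit n : set X := \bigcup_(i in `I_(h n)) (iter i T @^-1` A).

Lemma measurable_visit n : measurable (visit n).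
Proof. by apply: bigcup_measurable => i _; exact: (measurable_iter_preimage T_mp). Qed.
Hint Resolve measurable_visit : core.

Let mTv n k : measurable (iter k T @^-1` visit n).
Proof. exact: (measurable_iter_preimage T_mp). Qed.
Hint Resolve mTv : core.

Definition visited_base n : \bar R := m (visit n `&` E n 0).

Lemma visited_base_le_copies n :
  (visited_base n <= \sum_(0 <= k < N n.+1)
     m (iter (start n k) T @^-1` visit n `&` E n.+1 0))%E.
Proof.
have mVE k : measurable (visit n `&` E n.+1 (start n k)) by exact: measurableI.
apply: (@le_trans _ _
    (\sum_(k < N n.+1) m (visit n `&` E n.+1 (start n k)))%E).
  apply: (@content_subadditive _ _ _ m _ (fun k => visit n `&` E n.+1 (start n k))) => //.
  - exact: measurableI.
  - move=> x [vx /(bottom_level_cut N_gt0)[k kN Ek]].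
    by rewrite -(bigcup_mkord _ (fun k => visit n `&` E n.+1 (start n k))); exists k.
rewrite big_mkord; apply: lee_sum => k _.
rewrite -(@measure_base_preimage n.+1 (start n k))//; first last.
  exact: start_lt.
rewrite setIC le_measure ?inE//; try by apply: measurableI => //;
  exact: (measurable_iter_preimage T_mp).
by apply: setSI => x [].
Qed.

Lemma iter_visit n k x : (k < N n.+1)%N ->
  visit n (iter (start n k) T x) -> visit n.+1 x.
Proof.
move=> kN [i /= ih]; rewrite -iterD => Ax; exists (i + start n k)%N => //.
by apply: leq_trans (start_le L kN); rewrite addnC ltn_add2l.
Qed.

(** Divided by the width of [B_n], the measure of the visited part of its base
does not decrease with [n]: a passage through [B_(n+1)] meets [A] as soon as its
passage through one of the copies of [B_n] does. *)
Lemma visited_base_cut n :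
  (visited_base n <= (N n.+1)%:R%:E * visited_base n.+1)%E.
Proof.
apply: (le_trans (visited_base_le_copies n)).
apply: (@le_trans _ _ (\sum_(0 <= k < N n.+1) visited_base n.+1)%E).
  rewrite big_nat [leRHS]big_nat; apply: lee_sum => k /andP[_ kN].
  rewrite le_measure ?inE//; try exact: measurableI.
  by apply: setSI => x; exact: iter_visit.
by rewrite sumr_const_nat subn0 mule_natl.
Qed.

Lemma visited_base_le_width n : (visited_base n <= (w n)%:E)%E.
Proof.
rewrite -(@measure_lifted_level n 0) ?height_gt0// le_measure ?inE//.
exact: measurableI.
Qed.

Lemma visited_base_fin_num n : visited_base n \is a fin_num.
Proof.
by rewrite ge0_fin_numE ?measure_ge0// (le_lt_trans (visited_base_le_width n)) ?ltry.
Qed.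

Lemma exists_visited_base : (0 < m A)%E -> exists n, (0 < visited_base n)%E.
Proof.
move=> A_gt0; apply: contrapT => /forallNP nv.
suff : m.-negligible A by move/negligibleP => /(_ mA) A0; rewrite A0 ltxx in A_gt0.
pose F n i := if (i < h n)%N then A `&` E n i else set0.
apply: (@negligibleS _ _ _ _ (\bigcup_n \bigcup_i F n i)).
  move=> x Ax; have [n _ [b /= /(nthP 0)[i]]] := extension_range ext x.
  rewrite size_column => ih <- Ex; exists n => //; exists i => //.
  by rewrite /F ih.
apply: negligible_bigcup => n; apply: negligible_bigcup => i; rewrite /F.
case: ifPn => ih; last exact: negligible_set0.
have mAE : measurable (A `&` E n i) by exact: measurableI.
have vn : (visited_base n <= 0)%E by rewrite leNgt; apply/negP/nv.
have le_v : (m (A `&` E n i) <= visited_base n)%E.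
  rewrite -(measure_base_preimage ih mAE)// setIC.
  have mT := measurable_iter_preimage T_mp i mAE.
  rewrite le_measure ?inE//; try exact: measurableI.
  by apply: setSI => y [Ay _]; exists i.
apply/negligibleP => //; apply/eqP; rewrite -measure_le0.
exact: le_trans le_v vn.
Qed.

Section Cost.
Hypothesis A_gt0 : (0 < m A)%E.
Hypothesis A_lty : (m A < +oo)%E.
Variable e : R.
Hypothesis entropy_le : (entropy m A (return_partition T A) <= e%:E)%E.

Let p s := normalized_measure m A (first_return T A s).
Let p_ge0 s : 0 <= p s. Proof. exact: first_return_prob_ge0. Qed.

Let mfr s : measurable (first_return T A s).
Proof. exact: (measurable_first_return T_mp mA). Qed.

(** The orbit of the base up to the top sweeps disjoint levels, so no mass of a
return set is counted twice. *)
Lemma sum_base_first_return_le n s :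
  (\sum_(0 <= i < h n) m (iter i T @^-1` first_return T A s `&` E n 0) <=
   m (first_return T A s))%E.
Proof.
apply: (@le_trans _ _
    (\sum_(0 <= i < h n) m (first_return T A s `&` E n i))%E); last first.
  by apply: sum_measure_disjoint_le => //; exact: trivIset_lifted_level.
rewrite big_nat [leRHS]big_nat; apply: lee_sum => i /andP[_ ih].
have mSE : measurable (first_return T A s `&` E n i) by exact: measurableI.
rewrite -(measure_iter_preimage T_mp i mSE); apply: le_measure_climbs.
- by apply: measurableI => //; exact: (measurable_iter_preimage T_mp).
- exact: (measurable_iter_preimage T_mp).
by move=> x climb [ax Ex]; split=> //; exact: (climb n 0%N i).
Qed.

(** The estimate of [visited_blocks_cost] along the passage of an orbit through
[B_(n+1)], integrated over the base.  The number of visited copies of [B_n]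
integrates to at least the measure of the visited part of the base of [B_n]; the
cost [- ln (p s / 4)] of a return after time [s] integrates to at most the
entropy plus [ln 4], times the measure of [A]. *)
Lemma visit_cost n (K : R) : 1 <= K ->
  (forall k, (1 <= k < N n.+1)%N -> (start n k < L n.+1 k.+1)%N) ->
  ln K * fine (visited_base n) <=
    fine (m A) * (e + ln 4) + (ln K + 4 * K) * w n.+1.
Proof.
move=> K1 L_gt; set H := h n.+1.
have H0 : (0 < H)%N by exact: height_gt0.
have HR0 : 0 < H%:R^-1 :> R by rewrite invr_gt0 ltr0n.
have lnK0 : 0 <= ln K by rewrite ln_ge0.
have K0 : 0 <= K by apply: le_trans K1.
(* Null return sets still receive a positive weight, as their points are not
   excluded from the pointwise estimate; with these weights the [r s] sum to at
   most 2 / 4. *)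
pose r s : R := (if p s == 0 then H%:R^-1 else p s) / 4.
pose c s : R := - ln (r s).
have r_gt0 s : 0 < r s.
  by rewrite /r divr_gt0//; case: eqP => // /eqP; rewrite lt0r p_ge0 andbT.
have r_le1 s : r s <= 1.
  rewrite /r ler_pdivrMr// mul1r; apply: (@le_trans _ _ 1); last by lra.
  case: ifP => _; last exact: first_return_prob_le1.
  by rewrite invf_le1 ?ltr0n// ler1n.
have c_ge0 s : 0 <= c s by rewrite /c oppr_ge0 ln_le0.
have sum_r : \sum_(1 <= s < H) r s <= 2^-1.
  apply: (@le_trans _ _ (\sum_(1 <= s < H) (p s + H%:R^-1) / 4)).
    apply: ler_sum => s _; rewrite ler_pM2r ?invr_gt0//.
    by case: eqP => [->|_]; rewrite ?add0r// lerDl ltW.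
  rewrite -mulr_suml big_split /= ler_pdivrMr//.
  have -> : 2^-1 * 4 = 1 + 1 :> R by lra.
  apply: lerD; first exact: sum_first_return_prob_le1.
  rewrite sumr_const_nat -[leRHS](@mulVf _ H%:R) ?gt_eqF ?ltr0n//.
  by rewrite -[leLHS]mulr_natr ler_wpM2l ?(ltW HR0)// ler_nat leq_subr.
pose t := [seq (i, s) | i <- index_iota 0 H, s <- index_iota 1 H].
pose G (j : nat * nat) := iter j.1 T @^-1` first_return T A j.2.
have mG j : measurable (G j) by exact: (measurable_iter_preimage T_mp).
have pointwise x : \sum_(k <- index_iota 0 (N n.+1))
      ln K * \1_(iter (start n k) T @^-1` visit n) x
    <= \sum_(j <- t) c j.2 * \1_(G j) x + (ln K + 4 * K).
  pose v i := `[< A (iter i T x) >].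
  pose f i := \sum_(1 <= s < H) c s * \1_(first_return T A s) (iter i T x).
  have f_ge0 i : 0 <= f i by rewrite sumr_ge0// => s _; rewrite mulr_ge0.
  have f_cost i g : (0 < g)%N -> (i + g < H)%N -> v i -> v (i + g)%N ->
      (forall j, (0 < j < g)%N -> ~~ v (i + j)%N) -> expR (- f i) <= r g.
    move=> g0 gH /asboolP vi /asboolP vg nv.
    rewrite -[leRHS]lnK ?posrE// ler_expR -[leRHS]opprK lerN2 -/(c g).
    rewrite /f (bigD1_seq g) ?mem_index_iota ?iota_uniq//=; last by lia.
    rewrite indicE mem_set ?mulr1; last first.
      split; first by split => //=; rewrite -iterD addnC.
      move=> [j /= jg]; rewrite -iterD addnC.
      by move: (nv j jg) => /asboolPn.
    by rewrite lerDl sumr_ge0// => s _; rewrite mulr_ge0.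
  have := visited_blocks_cost (fun g => ltW (r_gt0 g)) L_gt K1 sum_r f_ge0 f_cost.
  rewrite -addrA big_allpairs -mulr_sumr; apply: le_trans.
  rewrite ler_wpM2l// ler_sum// => k _; rewrite indicE ler_nat.
  have [|//] := boolP (x \in _); rewrite inE => -[i /= ih Ax].
  rewrite lt0b; apply/existsP; exists (Ordinal ih); apply/asboolP => /=.
  by rewrite addnC iterD.
have lnK_ge0 (k : nat) : 0 <= ln K by [].
have := sum_indic_measure_le m (measurable_lifted_level n.+1 0)
  (fun k => mTv n (start n k)) mG lnK_ge0 (fun j => c_ge0 j.2) _
  (fun x _ => pointwise x).
rewrite addr_ge0 ?mulr_ge0// => /(_ isT).
rewrite measure_lifted_level//.
have vk : ((ln K)%:E * visited_base n <= \sum_(0 <= k < N n.+1)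
    (ln K)%:E * m (iter (start n k) T @^-1` visit n `&` E n.+1 0))%E.
  rewrite -ge0_sume_distrr; last by move=> k _; exact: measure_ge0.
  by rewrite lee_wpmul2l ?lee_fin//; exact: visited_base_le_copies.
move=> /(le_trans vk).
have sumG : (\sum_(j <- t) (c j.2)%:E * m (G j `&` E n.+1 0) <=
    (fine (m A) * (e + ln 4))%:E)%E.
  rewrite big_allpairs exchange_big /=.
  apply: (@le_trans _ _ (\sum_(1 <= s < H) (c s)%:E * m (first_return T A s))%E).
    apply: lee_sum => s _; rewrite -ge0_sume_distrr; last by move=> i _; exact: measure_ge0.
    by rewrite lee_wpmul2l ?lee_fin//; exact: sum_base_first_return_le.
  under eq_bigr do rewrite (measure_first_returnE T_mp mA A_gt0 A_lty) -EFinM.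
  rewrite sumEFin lee_fin.
  have -> : \sum_(1 <= s < H) c s * (fine (m A) * p s) =
      fine (m A) * \sum_(1 <= s < H) (p s * ln (1 / p s) + p s * ln 4).
    rewrite mulr_sumr; apply: eq_bigr => s _; rewrite mulrCA; congr (_ * _).
    rewrite /c /r; case: eqP => [->|/eqP ps]; first by rewrite mulr0 !mul0r addr0.
    have ps0 : 0 < p s by rewrite lt0r ps p_ge0.
    rewrite ln_div ?posrE// div1r lnV ?posrE// opprB -mulrDr addrC.
    by rewrite mulrC.
  rewrite ler_wpM2l ?fine_ge0// big_split /= lerD//.
    rewrite -lee_fin; apply: le_trans entropy_le.
    exact: sum_first_return_info_le.
  rewrite -mulr_suml ler_piMl ?ln_ge0//; last exact: sum_first_return_prob_le1.
  by rewrite ler1n.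
rewrite -(fineK (visited_base_fin_num n)) -EFinM => h1.
have := le_trans h1 (leeD2r _ sumG).
by rewrite -EFinM -EFinD lee_fin.
Qed.

End Cost.
End Visits.
End LiftedTower.

(** * Growing columns exclude quasi finite sets *)

Theorem proposition2p1 (R : realType) (N : nat -> nat) (L : nat -> nat -> nat)
    (N_gt0 : forall n, (1 <= n)%N -> (0 < N n)%N)
    (N_growth : forall n, (1 <= n)%N ->
      expR (n * \prod_(1 <= i < n.+1) N i)%N%:R <= (N n.+1)%:R :> R)
    (L_growth : forall n k, (1 <= n)%N -> (1 <= k < N n)%N ->
      (\sum_(1 <= j < k.+1) L n j + k * height N L n.-1 < L n k.+1)%N)
    (x0 : R) (sp : nat -> nat -> nat -> R) (T0 : R -> R)
    (levels_disj : disjoint_levels N L x0 sp)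
    (T0_tower : tower_map N L x0 sp T0)
    (d : measure_display) (X : measurableType d)
    (m : {measure set X -> \bar R}) (T : X -> X) (pi : X -> R)
    (ext : extension m T (tower_space N L x0 sp) lebesgue_measure T0 pi) :
  ~ quasi_finite m T.
Proof.
move=> [A [mA A_gt0 A_lty ent_lty]].
have info_le := sum_first_return_info_le m T A.
set e := fine (entropy m A (return_partition T A)).
have ent_le : (entropy m A (return_partition T A) <= e%:E)%E.
  rewrite /e fineK// ge0_fin_numE//; apply: le_trans (info_le 0%N).
  by rewrite big_geq.
pose vb n := fine (visited_base N L x0 sp m T pi A n).
have vb_fin := visited_base_fin_num N_gt0 ext mA.
have w_gt0 := width_gt0 R N_gt0.
have [n0 vb_n0] := exists_visited_base N_gt0 T0_tower ext mA A_gt0.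
(* By monotonicity, [q] bounds from below the fraction of the base of [B_n]
   that is visited, for all [n >= n0]. *)
pose q := vb n0 / width R N n0.
have q_gt0 : 0 < q.
  by rewrite divr_gt0// -lte_fin fineK.
have vb_ge n : (n0 <= n)%N -> q * width R N n <= vb n.
  elim: n => [|n IH]; first by rewrite leqn0 => /eqP <-; rewrite /q divfK ?gt_eqF.
  rewrite leq_eqVlt => /predU1P[<-|/IH qn]; first by rewrite /q divfK ?gt_eqF.
  have NR : 0 < (N n.+1)%:R :> R by rewrite ltr0n N_gt0.
  rewrite /= mulrA ler_pdivrMr// [leRHS]mulrC (le_trans qn)// -lee_fin EFinM.
  by rewrite !fineK//; exact: (visited_base_cut N_gt0 T0_tower ext mA).
pose C := fine (m A) * (e + ln 4).
(* [visit_cost] with [K] the number of copies: the error terms cost at most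
   [5 * K] times the width of [B_(n+1)], which is 5 times the width of [B_n],
   while [ln K] is at least [n] over the width of [B_n]. *)
have q_bound n : (n0 <= n)%N -> (1 <= n)%N -> n%:R * q <= C + 5.
  move=> nn n1; set K : R := (N n.+1)%:R.
  have K1 : 1 <= K by rewrite ler1n N_gt0.
  have K0 : 0 < K by apply: lt_le_trans K1.
  have := visit_cost N_gt0 levels_disj T0_tower ext mA A_gt0 A_lty ent_le K1.
  move=> /(_ n) cost.
  have wK : width R N n.+1 * K = width R N n by rewrite /= divfK ?gt_eqF.
  have w_le1 : width R N n <= 1.
    rewrite widthE invf_le1 ?ltr0n ?ler1n; last first.
      by rewrite big_nat; apply: prodn_cond_gt0 => i /andP[i1 _]; exact: N_gt0.
    by rewrite big_nat; apply: prodn_cond_gt0 => i /andP[i1 _]; exact: N_gt0.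
  have lnK : ln K <= K.
    have h := @le_ln1Dx R (K - 1); rewrite [1 + _]addrC subrK in h.
    apply: (le_trans (h _)); first by rewrite ltrBrDr addNr.
    by rewrite gerBl.
  have nw : n%:R <= ln K * width R N n.
    rewrite widthE ler_pdivlMr; last first.
      rewrite ltr0n big_nat; apply: prodn_cond_gt0 => i /andP[i1 _]; exact: N_gt0.
    by rewrite -natrM -[leLHS]expRK ler_ln ?posrE ?expR_gt0//; exact: N_growth.
  have {}cost : ln K * vb n <= C + 5.
    apply: le_trans (cost _) _.
      move=> k kN; have := L_growth n.+1 k isT kN.
      by rewrite /offset addnC.
    rewrite lerD2l; apply: (@le_trans _ _ (5 * K * width R N n.+1)).
      rewrite ler_wpM2r ?(ltW (w_gt0 _))//.
      by have -> : 5 * K = K + 4 * K; rewrite ?lerD2r// -nat1r mulrDl mul1r.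
    by rewrite -mulrA [K * _]mulrC wK ler_piMr.
  apply: le_trans cost; apply: (@le_trans _ _ (ln K * (q * width R N n))).
    by rewrite [leRHS]mulrCA [leLHS]mulrC ler_pM2l.
  by rewrite ler_wpM2l ?ln_ge0// vb_ge.
pose n := (maxn n0 1 + (Num.trunc ((C + 5) / q)).+1)%N.
have := q_bound n; rewrite -ler_pdivlMr// /n.
move=> /(_ (leq_trans (leq_maxl _ _) (leq_addr _ _))).
move=> /(_ (leq_trans (leq_maxr _ _) (leq_addr _ _))).
apply/negP; rewrite -ltNge.
apply: (@lt_le_trans _ _ (Num.trunc ((C + 5) / q)).+1%:R).
  have [Cq|Cq] := leP 0 ((C + 5) / q); last exact: lt_le_trans Cq _.
  by have /andP[] := truncn_itv Cq.
by rewrite ler_nat leq_addl.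
Qed.
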